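(* Let $I$ be a set and let $\mathcal F$ be a set of filters over $I$. (1) A topological space $X$ is $\mathcal Fc$-Frolík if and only if $X$ is sequencewise $(\mathcal F \cap \mathcal G)$-compact for every $\mathcal G \in \mathbf{Spec}_I(\mathcal Fc)$. (2) More generally, if $\mathcal H$ is a class of topological spaces, then a topological space $X$ is $\mathcal Fc$-Frolík for $\mathcal H$-spaces if and only if $X$ is sequencewise $(\mathcal F \cap \mathcal G)$-compact for every $\mathcal G \in \mathbf{Spec}_I(\mathcal H)$.
   Context: No separation axioms are assumed. Filters are allowed to be improper (the power set $P(I)$ counts as a filter over $I$). For a filter $F$ over a set $I$, a sequence $(x_i)_{i\in I}$ of elements of a topological space $X$ is said to $F$-converge to $x\in X$ if $\{i\in I \mid x_i\in U\}\in F$ for every neighborhood $U$ of $x$ in $X$; it $F$-converges in $X$ if it $F$-converges to some $x \in X$. For a family $\mathcal F$ of filters over $I$, a topological space $X$ is sequencewise $\mathcal F$-compact if for every sequence $(x_i)_{i\in I}$ of elements of $X$ there is $F\in\mathcal F$ such that $(x_i)_{i\in I}$ $F$-converges in $X$. The class of all sequencewise $\mathcal F$-compact spaces is denoted by $\mathcal Fc$. If $Y$ is a topological space and $\mathbf y=(y_i)_{i\in I}$ is a sequence of elements of $Y$, then $Spec(\mathbf y,Y)$ is the set of all filters $F$ over $I$ such that $\mathbf y$ $F$-converges in $Y$. For a class $\mathcal H$ of topological spaces, $\mathbf{Spec}_I(\mathcal H)=\{Spec(\mathbf y,Y)\mid Y\in\mathcal H \text{ and } \mathbf y \text{ is an }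 I\text{-indexed sequence of elements of } Y\}$. For classes $\mathcal K,\mathcal H$ of topological spaces, a topological space $X$ is $\mathcal K$-Frolík for $\mathcal H$-spaces if $X\times Y\in\mathcal K$ whenever $Y\in\mathcal H$ (product topology). $X$ is $\mathcal K$-Frolík if it is $\mathcal K$-Frolík for $\mathcal K$-spaces. *)

(* Defs.v *)
From mathcomp Require Import all_boot.
From mathcomp Require Import boolp classical_sets filter topology.

Set Implicit Arguments.
Unset Strict Implicit.
Unset Printing Implicit Defensive.

Local Open Scope classical_set_scope.

(* An existential, because the library's [cvg] requires a pointed type and
   hence would exclude empty spaces. *)
Definition Fconverges (I : Type) (X : topologicalType) (F : set_system I)
    (x : I -> X) : Prop :=
  exists l : X, x @ F --> l.

(* [Filter], unlike [ProperFilter], admits the improper filter. *)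
Definition filter_family (I : Type) (FF : set (set_system I)) : Prop :=
  forall F : set_system I, FF F -> Filter F.

Definition seqwise_compact (I : Type) (FF : set (set_system I))
    (X : topologicalType) : Prop :=
  forall x : I -> X, exists2 F : set_system I, FF F & Fconverges F x.

Definition Spec (I : Type) (Y : topologicalType) (y : I -> Y) :
    set (set_system I) :=
  [set F | Filter F /\ Fconverges F y].

Definition SpecClass (I : Type) (H : topologicalType -> Prop) :
    set (set (set_system I)) :=
  [set GG | exists Y : topologicalType,
              H Y /\ exists y : I -> Y, GG = Spec y].

Arguments SpecClass I H : clear implicits.

Definition Frolik_for (K H : topologicalType -> Prop)
    (X : topologicalType) : Prop :=
  forall Y : topologicalType, H Y -> K (X * Y)%type.

Definition Frolik (K : topologicalType -> Prop) (X : topologicalType) : Prop :=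
  Frolik_for K K X.

(* Main.v *)
Require Import Defs.
From mathcomp Require Import all_boot.
From mathcomp Require Import boolp classical_sets filter topology.

(** For a filter [F], a sequence of pairs [F]-converges in [X * Y] exactly when
    both of its components [F]-converge.  An [I]-sequence in [X * Y] is a pair
    of a sequence [x] in [X] and a sequence [y] in [Y], so sequencewise
    compactness of [X * Y] asks, for each [x] and [y], for some [F] in [FF]
    along which both converge, that is, for some [F] in [FF `&` Spec y] along
    which [x] converges.  Letting [Y] and [y] vary, [Spec y] runs over the
    members of the spectrum of the class.  The key step is
    [Fconverges_pair]. *)

Set Implicit Arguments.
Unset Strict Implicit.
Unset Printing Implicit Defensive.

Local Open Scope classical_set_scope.

(** The neighborhoods of a point of the product are generated by the boxes, so
    convergence to the point is componentwise.  Closure of [F] under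
    intersection is what combines the two sides of a box. *)
Lemma Fconverges_pair (I : Type) (X Y : topologicalType) (F : set_system I)
    (FF : Filter F) (x : I -> X) (y : I -> Y) :
  Fconverges F (fun i => (x i, y i)) <-> Fconverges F x /\ Fconverges F y.
Proof.
split=> [[[a b] xyab]|[[a xa] [b yb]]]; last by exists (a, b); exact: cvg_pair.
split.
- exists a; apply: (cvg_comp (fun i => (x i, y i)) fst xyab); exact: cvg_fst.
- exists b; apply: (cvg_comp (fun i => (x i, y i)) snd xyab); exact: cvg_snd.
Qed.

Lemma seqwise_compact_prod (I : Type) (FF : set (set_system I))
    (hFF : filter_family FF) (X Y : topologicalType) :
  seqwise_compact FF (X * Y)%type <->
  (forall y : I -> Y, seqwise_compact (FF `&` Spec y) X).
Proof.
split=> [cXY y x|cX z].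
- have [F FFF xyF] := cXY (fun i => (x i, y i)).
  have filtF := hFF F FFF.
  have [xF yF] := (Fconverges_pair filtF x y).1 xyF.
  by exists F.
- have [F [FFF [filtF yF]] xF] := cX (snd \o z) (fst \o z).
  exists F => //.
  have -> : z = (fun i => ((fst \o z) i, (snd \o z) i)).
    by apply/funext => i /=; case: (z i).
  by apply/Fconverges_pair.
Qed.

Lemma Frolik_forP (I : Type) (FF : set (set_system I))
    (hFF : filter_family FF) (H : topologicalType -> Prop)
    (X : topologicalType) :
  Frolik_for (seqwise_compact FF) H X <->
  (forall GG : set (set_system I),
     SpecClass I H GG -> seqwise_compact (FF `&` GG) X).
Proof.
split=> [fX GG [Y [HY [y ->]]]|cX Y HY].
- by apply: (seqwise_compact_prod hFF X Y).1; exact: fX.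
- apply/(seqwise_compact_prod hFF) => y.
  by apply: cX; exists Y; split=> //; exists y.
Qed.

Theorem proposition2 (I : Type) (FF : set (set_system I))
    (hFF : filter_family FF) :
  (forall X : topologicalType,
     Frolik (seqwise_compact FF) X <->
     (forall GG : set (set_system I),
        SpecClass I (seqwise_compact FF) GG ->
        seqwise_compact (FF `&` GG) X)) /\
  (forall (H : topologicalType -> Prop) (X : topologicalType),
     Frolik_for (seqwise_compact FF) H X <->
     (forall GG : set (set_system I),
        SpecClass I H GG -> seqwise_compact (FF `&` GG) X)).
Proof.
by split=> [X|H X]; exact: Frolik_forP.
Qed.
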